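(* Let $\mathcal{C}\subseteq\mathbb{R}^n$ be a compact convex set, let $f\colon\mathcal{C}\to\mathbb{R}$ be convex and differentiable in an open set containing $\mathcal{C}$, let $\eta_t=\frac{\ell}{t+\ell}$ for some integer $\ell\ge 1$ and all $t\in\mathbb{N}$, and suppose that $(\mathcal{C},f)$ satisfies the strong $(M,1)$-growth property for some $M>0$. Let $$S=\min\{i\in\mathbb{N},\ i\ge 1 \mid M\eta_i/2\le 1\}=\max\left\{1,\left\lceil \tfrac{\ell M}{2}-\ell\right\rceil\right\}.$$ Let $(x_t)_{t\in\mathbb{N}}$ be the iterates of the Frank-Wolfe algorithm with step-sizes $\eta_t$. Then: (i) For all integers $t\ge S$, $$\mathrm{primaldual}_t\le \mathrm{primaldual}_S\left(\frac{\eta_{t-1}}{\eta_{S-1}}\right)^{\ell}\exp\left(\frac{M\ell^2}{2S}\right)=\mathcal{O}(t^{-\ell}).$$ (ii) Let $c=\exp(1/\ell)$ and $\epsilon\in(0,1)$. Then, for all integers $t\ge 1$ with $t\ge\left\lceil c\cdot\frac{\ell M}{2(1-\epsilon)}-\ell+1\right\rceil$, $$\min_{i\in\{0,1,\ldots,t\}}\mathrm{gap}_i\le \mathrm{primaldual}_S\left(\frac{\eta_{t-1}}{\eta_{S-1}}\right)^{\ell}\frac{\exp\left(3+\frac{M\ell^2}{2S}\right)}{\epsilon}=\mathcal{O}(t^{-\ell}).$$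
   Context: $\mathbb{N}=\{0,1,2,\ldots\}$. Frank-Wolfe algorithm for $\min_{x\in\mathcal{C}}f(x)$ with step-sizes $\eta_t\in[0,1]$: given any $x_0\in\mathcal{C}$, for $t=0,1,2,\ldots$ choose any $v_t\in\operatorname{argmin}_{v\in\mathcal{C}}\langle\nabla f(x_t),v-x_t\rangle$ and set $x_{t+1}=x_t+\eta_t(v_t-x_t)$. For $x,y\in\mathcal{C}$: $D_f(y,x)=f(y)-f(x)-\langle\nabla f(x),y-x\rangle$ and $\mathrm{gap}(x)=\max_{v\in\mathcal{C}}\langle\nabla f(x),x-v\rangle$. For the iterates, $\mathrm{gap}_t=\mathrm{gap}(x_t)$ and $$\mathrm{primaldual}_t=\min_{k=0,\ldots,t}\{f(x_t)+f^*(\nabla f(x_k))+\sigma_{\mathcal{C}}(-\nabla f(x_k))\}=\min_{k=0,\ldots,t}\{f(x_t)-f(x_k)+\mathrm{gap}(x_k)\},$$ where $f^*(u)=\sup_{x\in\mathcal{C}}\{\langle u,x\rangle-f(x)\}$ and $\sigma_{\mathcal{C}}(u)=\max_{x\in\mathcal{C}}\langle u,x\rangle$. For $M>0$ and $r\in[0,1]$, $(\mathcal{C},f)$ satisfies the strong $(M,r)$-growth property if for all $x\in\mathcal{C}$ and all $v\in\operatorname{argmin}_{y\in\mathcal{C}}\langle\nabla f(x),y-x\rangle$, $$D_f(x+\eta(v-x),x)\le\frac{M\eta^2}{2}\,\mathrm{gap}(x)^r\quad\text{for all }\eta\in[0,1].$$ *)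

(* Defs.v *)
From HB Require Import structures.
From mathcomp Require Import all_boot all_order all_algebra.
From mathcomp Require Import all_classical all_reals all_analysis.

Set Implicit Arguments.
Unset Strict Implicit.
Unset Printing Implicit Defensive.

Import Order.TTheory GRing.Theory Num.Theory.
Import numFieldNormedType.Exports.

Local Open Scope classical_set_scope.
Local Open Scope ring_scope.

Section FrankWolfe.
Variables (R : realType) (n : nat).
Implicit Types (C : set 'rV[R]_n) (f : 'rV[R]_n -> R) (u v x y : 'rV[R]_n).

Definition dotp u v : R := \sum_(i < n) u 0 i * v 0 i.

(* Coordinates of the Frechet differential; meaningful where f is
   differentiable. *)
Definition grad f x : 'rV[R]_n := \row_(i < n) 'd f x (delta_mx 0 i).

Definition bregman f y x : R := f y - f x - dotp (grad f x) (y - x).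

Definition fw_argmin C f x : set 'rV[R]_n :=
  [set v | C v /\
    forall y, C y -> dotp (grad f x) (v - x) <= dotp (grad f x) (y - x)].

(* In the next three definitions sup is the real-valued supremum.  For C compact
   and nonempty and f continuous on C, the sets are nonempty and bounded and the
   suprema are attained, so that sup is also the maximum. *)
Definition gap C f x : R := sup [set dotp (grad f x) (x - v) | v in C].

Definition support_fun C u : R := sup [set dotp u x | x in C].

Definition conjugate C f u : R := sup [set dotp u x - f x | x in C].

(* Minimum of a 0, ..., a t. *)
Definition running_min (a : nat -> R) (t : nat) : R :=
  \big[Num.min/a 0%N]_(k < t.+1) a k.

Definition primaldual C f (x : nat -> 'rV[R]_n) (t : nat) : R :=
  running_min (fun k => f (x t) + conjugate C f (grad f (x k))
                        + support_fun C (- grad f (x k))) t.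

Definition frank_wolfe C f (eta : nat -> R) (x : nat -> 'rV[R]_n) : Prop :=
  C (x 0%N) /\
  exists v : nat -> 'rV[R]_n, forall t,
    fw_argmin C f (x t) (v t) /\ x t.+1 = x t + eta t *: (v t - x t).

(* Real powers are taken with the convention 0 `^ 0 = 1. *)
Definition strong_growth C f (M r : R) : Prop :=
  forall x v, C x -> fw_argmin C f x v ->
  forall eta : R, 0 <= eta <= 1 ->
    bregman f (x + eta *: (v - x)) x <= M * eta ^+ 2 / 2 * gap C f x `^ r.

End FrankWolfe.

Definition open_loop_step (R : realType) (l t : nat) : R := l%:R / (t + l)%:R.

(* Main.v *)
Require Import Defs.
From mathcomp Require Import all_boot all_order all_algebra.
From mathcomp Require Import all_classical all_reals all_analysis.
From mathcomp Require Import ring lra.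
Import Order.TTheory GRing.Theory Num.Theory.
Import numFieldNormedType.Exports.
Local Open Scope classical_set_scope.
Local Open Scope ring_scope.

(* The growth property and the Frank-Wolfe step give the descent
   [f (x (t+1)) <= f (x t) - eta t (1 - M eta t / 2) gap t].  Convexity turns
   the primal-dual gap into [f (x t) - f (x k) + gap k] minimized over [k <= t],
   so it is at most [gap t]; once [M eta t / 2 <= 1] it is therefore multiplied
   by at most [1 - eta t + M eta t ^ 2 / 2] at each step, and the product of
   these factors gives (i).  For (ii), summing the descent over a window [k, t]
   bounds the smallest gap by [primaldual k / (epsilon * sum of eta)]; the window
   is chosen with [(t + l) / (k + l)] about [exp (1 / l)], so that the sum is at
   least 1/2 while (i) at [k] loses only a factor [exp 2]. *)

(** * Running minima and attained suprema *)

Lemma running_min_le (R : realType) (a : nat -> R) (t k : nat) :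
  (k <= t)%N -> running_min a t <= a k.
Proof.
move=> kt; rewrite /running_min.
exact: (@bigmin_le_cond _ _ _ _ (Ordinal (kt : (k < t.+1)%N)) xpredT
          (fun i : 'I_t.+1 => a i)).
Qed.

Lemma running_min_ge (R : realType) (a : nat -> R) (t : nat) (b : R) :
  (forall k, (k <= t)%N -> b <= a k) -> b <= running_min a t.
Proof.
move=> ba; apply: le_bigmin; first exact: ba.
by move=> i _; apply: ba; rewrite -ltnS.
Qed.

Lemma eq_running_min (R : realType) (a b : nat -> R) :
  a =1 b -> running_min a =1 running_min b.
Proof. by move=> /funext ->. Qed.

Lemma sup_attained (R : realType) (A : set R) (m : R) :
  A m -> ubound A m -> sup A = m.
Proof.
move=> Am Aub; apply/eqP; rewrite eq_le; apply/andP; split.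
  by apply: ge_sup => //; exists m.
by apply: ub_le_sup => //; exists m.
Qed.

(** * Inner products and the first-order inequality for convex functions *)

Section Gradient.
Variables (R : realType) (n : nat).
Implicit Types (C : set 'rV[R]_n) (f : 'rV[R]_n -> R) (u v x y : 'rV[R]_n).

Lemma dotpDr u v x : dotp u (v + x) = dotp u v + dotp u x.
Proof. by rewrite -big_split; apply: eq_bigr => i _; rewrite mxE mulrDr. Qed.

Lemma dotpNr u v : dotp u (- v) = - dotp u v.
Proof. by rewrite -sumrN; apply: eq_bigr => i _; rewrite mxE mulrN. Qed.

Lemma dotpNl u v : dotp (- u) v = - dotp u v.
Proof. by rewrite -sumrN; apply: eq_bigr => i _; rewrite mxE mulNr. Qed.

Lemma dotpZr a u v : dotp u (a *: v) = a * dotp u v.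
Proof.
by rewrite mulr_sumr; apply: eq_bigr => i _; rewrite mxE mulrCA.
Qed.

Lemma diff_dotp f x v : 'd f x v = dotp (grad f x) v.
Proof.
rewrite [in LHS](row_sum_delta v) linear_sum; apply: eq_bigr => i _.
by rewrite linearZ mxE mulrC.
Qed.

Lemma convex_function_le C f x y (h : R) :
  convex_function C f -> C x -> C y -> 0 <= h -> h <= 1 ->
  f (h *: (y - x) + x) <= h * f y + (1 - h) * f x.
Proof.
move=> cvxf Cx Cy h0 h1.
have -> : h *: (y - x) + x = h *: y + (1 - h) *: x.
  by rewrite scalerBl scale1r scalerBr addrA addrAC.
exact: (cvxf (Itv01 h0 h1) y x (mem_set Cy) (mem_set Cx)).
Qed.

(** By convexity the secant slope of [f] from [x] towards [y] is at most [f y - f x] for every step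
    [h] in (0, 1]; let [h] tend to 0. The limit is taken from the right, since convexity is only
    available for such [h]. *)
Lemma gradient_inequality C f x y :
  convex_function C f -> differentiable f x -> C x -> C y ->
  dotp (grad f x) (y - x) <= f y - f x.
Proof.
move=> cvxf df Cx Cy; rewrite -diff_dotp -deriveE // /derive.
have := diff_derivable (v := y - x) df; rewrite /derivable => cvgD.
rewrite cvg_at_rightE //; apply: limr_le.
  exact: (cvgP _ (cvg_dnbhs_at_right cvgD)).
near=> h.
have h0 : 0 < h by near: h; exact: nbhs_right_gt.
have h1 : h <= 1 by near: h; exact: nbhs_right_le.
have := convex_function_le C f x y h cvxf Cx Cy (ltW h0) h1.
have -> : h * f y + (1 - h) * f x = h * (f y - f x) + f x by ring.
by rewrite -lerBlDr -ler_pdivrMl.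
Unshelve. all: by end_near.
Qed.

End Gradient.

(** * Gap, duality and descent along the iterates *)

Section Iterates.
Variables (R : realType) (n : nat).
Implicit Types (C : set 'rV[R]_n) (f : 'rV[R]_n -> R) (u v x y : 'rV[R]_n).

Lemma convex_set_segment C x v (h : R) :
  convex_set C -> C x -> C v -> 0 <= h <= 1 -> C (x + h *: (v - x)).
Proof.
move=> cvxC Cx Cv /andP[h0 h1].
have -> : x + h *: (v - x) = h *: v + (1 - h) *: x.
  by rewrite scalerBl scale1r scalerBr addrCA.
exact: (set_mem (cvxC v x (Itv01 h0 h1) (mem_set Cv) (mem_set Cx))).
Qed.

Lemma frank_wolfe_mem C f (eta : nat -> R) (x : nat -> 'rV[R]_n) :
  convex_set C -> (forall t, 0 <= eta t <= 1) -> frank_wolfe C f eta x ->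
  forall t, C (x t).
Proof.
move=> cvxC eta01 [Cx0 [v xv]]; elim=> // t Cxt.
have [[Cv _] ->] := xv t; exact: convex_set_segment.
Qed.

Lemma dotp_le_gap C f x v y :
  fw_argmin C f x v -> C y -> dotp (grad f x) (x - y) <= dotp (grad f x) (x - v).
Proof.
by move=> [_ vmin] /vmin; rewrite -[x - y]opprB -[x - v]opprB !dotpNr lerN2.
Qed.

Lemma gap_argmin C f x v :
  fw_argmin C f x v -> gap C f x = dotp (grad f x) (x - v).
Proof.
move=> vmin; apply: sup_attained; first by exists v => //; case: vmin.
by move=> _ [y Cy <-]; exact: (dotp_le_gap C).
Qed.

Lemma gap_ge0 C f x v : C x -> fw_argmin C f x v -> 0 <= gap C f x.
Proof.
move=> Cx vmin; rewrite (gap_argmin _ _ _ v vmin).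
have := dotp_le_gap _ _ _ _ _ vmin Cx.
by rewrite subrr -(scale0r 0) dotpZr mul0r.
Qed.

(** Equality case of Fenchel-Young: by the gradient inequality, [x] itself attains the supremum. *)
Lemma conjugate_grad C f x :
  convex_function C f -> differentiable f x -> C x ->
  conjugate C f (grad f x) = dotp (grad f x) x - f x.
Proof.
move=> cvxf df Cx; apply: sup_attained; first by exists x.
move=> _ [y Cy <-]; have := gradient_inequality _ _ _ _ x y cvxf df Cx Cy.
rewrite dotpDr dotpNr; lra.
Qed.

Lemma support_fun_grad C f x v :
  fw_argmin C f x v -> support_fun C (- grad f x) = - dotp (grad f x) v.
Proof.
move=> [Cv vmin]; apply: sup_attained; first by exists v => //; rewrite dotpNl.
move=> _ [y /vmin + <-]; rewrite dotpNl !dotpDr; lra.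
Qed.

(** With both suprema attained, at [x k] and at [v k], the two dual terms add up to
    [gap - f (x k)]. *)
Lemma primaldualE C f (eta : nat -> R) (x : nat -> 'rV[R]_n) :
  convex_function C f -> (forall t, differentiable f (x t)) ->
  (forall t, C (x t)) -> frank_wolfe C f eta x ->
  primaldual C f x =1
    fun t => running_min (fun k => f (x t) - f (x k) + gap C f (x k)) t.
Proof.
move=> cvxf df Cx [_ [v xv]] t; apply: eq_running_min => k.
have [vmin _] := xv k.
rewrite (conjugate_grad C) // (support_fun_grad _ _ _ _ vmin).
rewrite (gap_argmin _ _ _ _ vmin) dotpDr dotpNr; ring.
Qed.

Lemma frank_wolfe_descent C f (M : R) (eta : nat -> R) (x : nat -> 'rV[R]_n) :
  (forall t, 0 <= eta t <= 1) -> (forall t, C (x t)) ->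
  strong_growth C f M 1 -> frank_wolfe C f eta x ->
  forall t,
  f (x t.+1) <= f (x t) - eta t * (1 - M * eta t / 2) * gap C f (x t).
Proof.
move=> eta01 Cx growth [_ [v xv]] t; have [vmin xS] := xv t.
(* The power with exponent 1 collapses because the gap is nonnegative. *)
have := growth _ _ (Cx t) vmin _ (eta01 t); rewrite powRr1; last first.
  exact: gap_ge0 (Cx t) vmin.
rewrite /bregman -xS addrC (_ : x t.+1 - x t = eta t *: (v t - x t)); last first.
  by rewrite xS addrC addKr.
have -> : dotp (grad f (x t)) (eta t *: (v t - x t)) = - (eta t * gap C f (x t)).
  by rewrite (gap_argmin _ _ _ _ vmin) dotpZr -opprB dotpNr mulrN.
set g := gap _ _ _; set e := eta t.
have -> : f (x t) - e * (1 - M * e / 2) * g =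
  f (x t) - e * g + M * e ^+ 2 / 2 * g by ring.
lra.
Qed.

(** The gap dominates the linear decrease towards every [y] in [C], and the linearization at [x]
    lies below [f]. *)
Lemma weak_duality C f x y v :
  convex_function C f -> differentiable f x -> C x -> C y ->
  fw_argmin C f x v -> f x - gap C f x <= f y.
Proof.
move=> cvxf df Cx Cy vmin; rewrite (gap_argmin _ _ _ _ vmin).
have := gradient_inequality _ _ _ _ x y cvxf df Cx Cy.
have := dotp_le_gap _ _ _ _ _ vmin Cy.
rewrite !dotpDr !dotpNr; lra.
Qed.

End Iterates.

(** * Estimates for the open-loop step-sizes *)

Section OpenLoopRate.
Variables (R : realType) (l : nat).
Hypothesis l_ge1 : (1 <= l)%N.
Local Notation eta := (open_loop_step R l).
Local Notation L := (l%:R : R).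

Let L_ge1 : 1 <= l%:R :> R. Proof. by rewrite ler1n. Qed.

Lemma open_loop_stepE t : eta t = L / (t%:R + L).
Proof. by rewrite /open_loop_step natrD. Qed.

Lemma open_loop_step_pred t : (1 <= t)%N -> eta t.-1 = L / (t%:R + L - 1).
Proof.
by move=> t1; rewrite open_loop_stepE -subn1 natrB // addrAC.
Qed.

Lemma open_loop_step_gt0 t : 0 < eta t.
Proof. by rewrite open_loop_stepE divr_gt0 //; move: L_ge1 (ler0n R t); lra. Qed.

Lemma open_loop_step01 t : 0 <= eta t <= 1.
Proof.
rewrite ltW ?open_loop_step_gt0 //= open_loop_stepE ler_pdivrMr.
  by move: L_ge1 (ler0n R t); lra.
by move: L_ge1 (ler0n R t); lra.
Qed.

Lemma bernoulli_ineq (y : R) m : 0 <= y <= 1 -> 1 - m%:R * y <= (1 - y) ^+ m.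
Proof.
move=> /andP[y0 y1]; elim: m => [|m IH]; first by rewrite mul0r subr0 expr0.
rewrite exprS -natr1; have : 0 <= m%:R :> R by [].
set k : R := m%:R in IH *; nra.
Qed.

(* Writing [1 - eta + M eta^2 / 2] as
   [(1 - eta) (1 + M l^2 / (2 t (t + l)))], the first factor is controlled by
   Bernoulli's inequality and the second by [1 + a <= exp a]; bounding
   [1 / (t (t + l))] by [1 / (t (t + 1))] makes the exponents telescope. *)
Lemma contraction_factor_le (M : R) t : 0 <= M -> (1 <= t)%N ->
  1 - eta t * (1 - M * eta t / 2) <=
  (eta t / eta t.-1) ^+ l
    * expR (M * L ^+ 2 / 2 * (t%:R^-1 - t.+1%:R^-1)).
Proof.
move=> M0 t1; have L1 := L_ge1; have T1 : 1 <= t%:R :> R by rewrite ler1n.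
rewrite (open_loop_step_pred t t1) open_loop_stepE -(natr1 t).
set T : R := t%:R in T1 *.
have -> : 1 - L / (T + L) * (1 - M * (L / (T + L)) / 2) =
    (1 - L * (T + L)^-1) * (1 + M * L ^+ 2 / 2 * (T * (T + L))^-1).
  by field; lra.
have -> : L / (T + L) / (L / (T + L - 1)) = 1 - (T + L)^-1 by field; lra.
have -> : T^-1 - (T + 1)^-1 = (T * (T + 1))^-1 by field; lra.
have TL : 0 < T + L by lra.
have y01 : 0 <= (T + L)^-1 <= 1.
  by rewrite invr_ge0 ltW //= invf_le1 //; lra.
apply: ler_pM.
- by rewrite subr_ge0 ler_pdivrMr //; lra.
- by rewrite addr_ge0 // mulr_ge0 ?divr_ge0 ?mulr_ge0 ?invr_ge0 ?mulr_ge0 ?exprn_ge0 //; lra.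
- exact: bernoulli_ineq.
- apply: le_trans (expR_ge1Dx _) _; rewrite ler_expR.
  apply: ler_wpM2l; first by rewrite divr_ge0 ?mulr_ge0 ?exprn_ge0 //; lra.
  rewrite lef_pV2 ?posrE ?mulr_gt0 //; try lra.
  by apply: ler_wpM2l; lra.
Qed.

(** Turns a smallness condition on the step into a lower bound on the index; [d = 1] gives the
    burn-in condition and [d = 1 - eps] the threshold in (ii). *)
Lemma open_loop_step_le (M d : R) i : 0 < d ->
  (M * eta i / 2 <= d) = (L * M / (2 * d) <= i%:R + L).
Proof.
move=> d0; have iL : 0 < i%:R + L by move: L_ge1 (ler0n R i); lra.
rewrite open_loop_stepE [RHS]ler_pdivrMr ?mulr_gt0 // ler_pdivrMr //.
rewrite mulrA ler_pdivrMr //; congr (_ <= _); ring.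
Qed.

Lemma open_loop_step_nincr i j : (i <= j)%N -> eta j <= eta i.
Proof.
move=> ij; rewrite !open_loop_stepE ler_wpM2l // lef_pV2 ?posrE.
- by rewrite lerD2r ler_nat.
- by move: L_ge1 (ler0n R j); lra.
- by move: L_ge1 (ler0n R i); lra.
Qed.

(* In terms of [T = t + l - 1] and [K = k + l - 1], take
   [K = max l (floor (T / c))].  Then [K + 1 > T / c], which gives
   [T / K <= c (1 + 1 / l) <= c ^ 2], and the window has step mass at least
   [l / (l + 1)]: through its first term if [K = l], and otherwise through its
   [T - K + 1] terms, all at least [l / (T + 1)]. *)
Lemma gap_window (A : R) t : (1 <= t)%N ->
  expR (1 / L) * A - L + 1 <= t%:R ->
  exists k, [/\ (1 <= k <= t)%N, A <= k%:R + L,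
    (eta k.-1 / eta t.-1) ^+ l <= expR 2 &
    1 / 2 <= \sum_(k <= i < t.+1) eta i].
Proof.
set c := expR (1 / L); move=> t1 At; have L1 := L_ge1.
have c1 : 1 + 1 / L <= c := expR_ge1Dx _.
have L'0 : 0 < 1 / L by rewrite divr_gt0 //; lra.
have c0 : 0 < c by lra.
have T1 : 1 <= t%:R :> R by rewrite ler1n.
set T : R := t%:R + L - 1.
have TL : L <= T by rewrite /T; lra.
pose m := Num.truncn (T / c).
have Tc0 : 0 <= T / c by rewrite divr_ge0 //; lra.
have mT : m%:R <= T / c by rewrite truncn_le.
have Tm : T / c < m%:R + 1 by rewrite natr1 truncnS_gt.
pose K := maxn l m; pose k := (K.+1 - l)%N.
have lK : (l <= K)%N by exact: leq_maxl.
have kK : k%:R = K%:R + 1 - L :> R by rewrite natrB ?leqW // -natr1.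
have LK : L <= K%:R by rewrite ler_nat.
have mK : m%:R <= K%:R :> R by rewrite ler_nat leq_maxr.
have TcT : T / c <= T by rewrite ler_pdivrMr // ler_peMr; lra.
have KT : K%:R <= T.
  by rewrite /K /maxn; case: ifP => _ //; apply: le_trans mT TcT.
have k1 : (1 <= k)%N by rewrite subn_gt0 ltnS.
have kt : (k <= t)%N by rewrite -(ler_nat R) kK; move: KT; rewrite /T; lra.
exists k; split.
- by rewrite k1.
(* The hypothesis on [t] reads [c A <= T], and [k + l = K + 1] exceeds [T / c]. *)
- have : A <= T / c by rewrite ler_pdivlMr // mulrC /T; lra.
  by rewrite kK; lra.
- rewrite !open_loop_step_pred // -/T.
  have -> : L / (k%:R + L - 1) / (L / T) = T / K%:R by rewrite kK; field; lra.
  have -> : expR 2 = (c * c) ^+ l.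
    rewrite /c -expRD -expRM_natl; congr expR; field; lra.
  have K0 : 0 < K%:R :> R by lra.
  apply: lerXn2r; rewrite ?nnegrE ?mulr_ge0 ?invr_ge0; try lra.
  rewrite ler_pdivrMr //.
  have TK : T <= c * (K%:R + 1) by rewrite mulrC -ler_pdivrMr //; lra.
  apply: le_trans TK _; rewrite -mulrA ler_wpM2l //; first lra.
  apply: (@le_trans _ _ ((1 + 1 / L) * K%:R)); last by rewrite ler_wpM2r //; lra.
  rewrite mulrDl mul1r lerD2l // mulrC mulrA mulr1 ler_pdivlMr ?mul1r //; lra.
- have L2 : 1 / 2 <= L / (1 + L) by rewrite ler_pdivlMr; lra.
  apply: (le_trans L2).
  have [ml|lm] := leqP m l.
    have k_eq : k = 1%N by rewrite /k /K (maxn_idPl ml) subSnn.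
    rewrite k_eq big_ltn; last by rewrite ltnS.
    rewrite open_loop_stepE lerDl sumr_ge0 // => i _.
    exact: ltW (open_loop_step_gt0 i).
  have KTc : K%:R * c <= T.
    by rewrite -ler_pdivlMr // /K (maxn_idPr (ltnW lm)).
  apply: (@le_trans _ _ (\sum_(k <= i < t.+1) eta t)); last first.
    by apply: ler_sum_nat => i /andP[_]; rewrite ltnS; exact: open_loop_step_nincr.
  rewrite sumr_const_nat -[_ *+ (_ - _)%N]mulr_natl natrB ?leqW // -natr1 kK open_loop_stepE.
  have -> : (t%:R + 1 - (K%:R + 1 - L)) * (L / (t%:R + L)) =
            L * ((T - K%:R + 1) / (T + 1)).
    by rewrite /T; field; lra.
  rewrite ler_wpM2l //.
  rewrite ler_pdivlMr; last lra.
  rewrite mulrC ler_pdivrMr; last lra.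
  (* Cross-multiplied, the goal asks for [(l + 1) K <= l (T + 1)]; it follows from [K c <= T] and
     [1 + 1 / l <= c]. *)
  have : K%:R * (1 + 1 / L) <= T.
    by apply: le_trans KTc; rewrite ler_wpM2l //; lra.
  have -> : 1 + 1 / L = (L + 1) / L by field; lra.
  rewrite mulrA ler_pdivrMr; last lra.
  lra.
Qed.

(** For [t >= 1], [eta t.-1 = l / (t + l - 1) <= l / t] because [l >= 1]; all other factors are
    constant in [t]. *)
Lemma open_loop_step_bigO (P Q : R) (S : nat) :
  ((fun t => P * (eta t.-1 / eta S.-1) ^+ l * Q) : nat -> R)
    =O_\oo (fun t : nat => t%:R ^- l : R).
Proof.
apply/eqO_exP; have L1 := L_ge1.
set a := `|P * (eta S.-1) ^- l * Q|.
have La0 : 0 <= a * L ^+ l by rewrite mulr_ge0 ?exprn_ge0 ?normr_ge0.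
(* The added 1 keeps the constant positive even when [a = 0]. *)
exists (a * L ^+ l + 1); first lra.
near=> t; have t1 : (1 <= t)%N by near: t; exact: nbhs_infty_ge.
have T1 : 1 <= t%:R :> R by rewrite ler1n.
have e0 : 0 <= eta t.-1 by exact: ltW (open_loop_step_gt0 _).
have -> : P * (eta t.-1 / eta S.-1) ^+ l * Q =
    P * (eta S.-1) ^- l * Q * eta t.-1 ^+ l.
  by rewrite exprMn exprVn; ring.
rewrite normrM -/a ger0_norm ?exprn_ge0 // ger0_norm ?invr_ge0 ?exprn_ge0 //.
apply: (@le_trans _ _ (a * L ^+ l * t%:R ^- l)); last first.
  by rewrite ler_wpM2r ?invr_ge0 ?exprn_ge0 // lerDl.
rewrite -mulrA ler_wpM2l ?normr_ge0 // -exprVn -exprMn.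
apply: lerXn2r; rewrite ?nnegrE ?mulr_ge0 ?invr_ge0 //.
rewrite open_loop_step_pred // ler_wpM2l //.
by rewrite lef_pV2 ?posrE; lra.
Unshelve. all: by end_near.
Qed.

(** * Rates (i) and (ii) for abstract sequences of values and gaps *)

Section Rate.
(** [F t] stands for [f (x t)] and [G t] for its gap; [dual_le] is weak duality and [descent] the
    one-step decrease. *)
Variables (M : R) (F G : nat -> R).
Hypothesis M_ge0 : 0 <= M.
Hypothesis G_ge0 : forall t, 0 <= G t.
Hypothesis dual_le : forall k t, F k - G k <= F t.
Hypothesis descent :
  forall t, F t.+1 <= F t - eta t * (1 - M * eta t / 2) * G t.
Let pd t := running_min (fun k => F t - F k + G k) t.

Lemma pd_ge0 t : 0 <= pd t.
Proof. by apply: running_min_ge => k _; have := dual_le k t; lra. Qed.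

Lemma pd_contract t : M * eta t / 2 <= 1 ->
  pd t.+1 <= (1 - eta t * (1 - M * eta t / 2)) * pd t.
Proof.
move=> Mt; set q := eta t * _.
have q0 : 0 <= q.
  by rewrite mulr_ge0 ?subr_ge0 //; case/andP: (open_loop_step01 t).
have pdG : pd t <= G t.
  by apply: le_trans (running_min_le _ _ _ _ (leqnn t)) _; lra.
(* Passing to [t.+1] shifts every old entry of the minimum by [F t.+1 - F t] and adds one new entry,
   which can only lower it. *)
have pdS : pd t.+1 <= pd t + (F t.+1 - F t).
  rewrite -lerBlDr; apply: running_min_ge => k kt; rewrite lerBlDr.
  by apply: le_trans (running_min_le _ _ _ _ (leqW kt)) _; lra.
have := descent t; rewrite -/q => dt.
have : q * pd t <= q * G t by exact: ler_wpM2l.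
lra.
Qed.

Lemma pd_rate S t : (1 <= S)%N ->
  (forall i, (S <= i)%N -> M * eta i / 2 <= 1) -> (S <= t)%N ->
  pd t <= pd S * (eta t.-1 / eta S.-1) ^+ l * expR (M * L ^+ 2 / (2 * S%:R)).
Proof.
move=> S1 small St.
have S0 : 0 < S%:R :> R by rewrite ltr0n.
have eta0 i : eta i != 0 by rewrite gt_eqF ?open_loop_step_gt0.
(* The induction needs the sharper exponent with [1 / S - 1 / t], which telescopes; the term
   [- 1 / t] is dropped only at the end. *)
suff H : pd t <= pd S * (eta t.-1 / eta S.-1) ^+ l
           * expR (M * L ^+ 2 / 2 * (S%:R^-1 - t%:R^-1)).
  apply: (le_trans H); rewrite ler_wpM2l //.
    by rewrite mulr_ge0 ?pd_ge0 // exprn_ge0 // divr_ge0 // ltW ?open_loop_step_gt0.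
  rewrite ler_expR (_ : _ / (2 * _) = M * L ^+ 2 / 2 * S%:R^-1) ?ler_wpM2l //.
    - by rewrite divr_ge0 ?mulr_ge0 ?exprn_ge0.
    - by rewrite gerBl invr_ge0.
    - by rewrite invfM mulrA.
elim: t St => [|t IH]; first by case: S S1 {small S0}.
rewrite leq_eqVlt => /predU1P[<-|].
  by rewrite divff // expr1n subrr mulr0 expR0 !mulr1.
rewrite ltnS => St; have t1 := leq_trans S1 St.
apply: le_trans (pd_contract t (small t St)) _.
apply: le_trans (ler_wpM2r (pd_ge0 t) (contraction_factor_le M t M_ge0 t1)) _.
apply: le_trans (ler_wpM2l _ (IH St)) _.
  by rewrite mulr_ge0 ?expR_ge0 // exprn_ge0 // divr_ge0 // ltW ?open_loop_step_gt0.
rewrite /= le_eqVlt; apply/orP; left; apply/eqP.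
have -> : S%:R^-1 - t.+1%:R^-1 =
  (S%:R^-1 - t%:R^-1) + (t%:R^-1 - t.+1%:R^-1) :> R by ring.
rewrite [in RHS]mulrDr expRD.
have -> : eta t / eta S.-1 = (eta t.-1 / eta S.-1) * (eta t / eta t.-1).
  by field; rewrite !eta0.
rewrite [in RHS]exprMn; set a := (eta t / _) ^+ l; set b := _ ^+ l.
by set u := expR _; set v := expR _; set w := pd _; ring.
Qed.

(* Summing the descent over the window [k, t] telescopes [F]; what remains is
   at most [pd k] because [F t.+1] dominates every dual value. *)
Lemma window_sum_le (eps g : R) k t : (k <= t)%N -> 0 <= g -> 0 <= eps ->
  (forall i, (k <= i <= t)%N -> g <= G i) ->
  (forall i, (k <= i)%N -> eps <= 1 - M * eta i / 2) ->
  g * eps * (\sum_(k <= i < t.+1) eta i) <= pd k.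
Proof.
move=> kt g0 eps0 gG epsM; apply: running_min_ge => j _.
have step m : (k <= m <= t.+1)%N ->
    g * eps * (\sum_(k <= i < m) eta i) <= F k - F m.
  move=> /andP[]; elim: m => [|m IH].
    by rewrite leqn0 => /eqP -> _; rewrite big_geq // mulr0 subrr.
  rewrite leq_eqVlt => /predU1P[-> _|]; first by rewrite big_geq // mulr0 subrr.
  rewrite ltnS => km mt; rewrite big_nat_recr //= mulrDr.
  have {}IH := IH km (ltnW mt); have dm := descent m.
  have gm : g <= G m by apply: gG; rewrite km.
  have em0 := ltW (open_loop_step_gt0 m).
  have : g * eps * eta m <= eta m * (1 - M * eta m / 2) * G m.
    rewrite mulrC -mulrA ler_wpM2l //= mulrC ler_pM //.
    exact: epsM.
  lra.
have := step t.+1; rewrite leqnn andbT (leqW kt) => /(_ isT).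
have := dual_le j t.+1; lra.
Qed.


Lemma gap_rate S (eps : R) t : 0 < eps < 1 -> (1 <= S)%N ->
  (forall i, (1 <= i)%N -> M * eta i / 2 <= 1 -> (S <= i)%N) ->
  (forall i, (S <= i)%N -> M * eta i / 2 <= 1) -> (1 <= t)%N ->
  expR (1 / L) * (L * M / (2 * (1 - eps))) - L + 1 <= t%:R ->
  running_min G t <=
  pd S * (eta t.-1 / eta S.-1) ^+ l
    * (expR (3 + M * L ^+ 2 / (2 * S%:R)) / eps).
Proof.
move=> /andP[eps0 eps1] S1 Smin small t1 tA.
have [k [/andP[k1 kt] kA ratio mass]] := gap_window _ t t1 tA.
have epsM i : (k <= i)%N -> M * eta i / 2 <= 1 - eps.
  move=> ki; rewrite open_loop_step_le ?subr_gt0 //.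
  by apply: le_trans kA _; rewrite lerD2r ler_nat.
(* As [1 - eps < 1], the index [k] already satisfies the burn-in condition, so (i) applies at
   [k]. *)
have Sk : (S <= k)%N by apply: Smin => //; have := epsM k (leqnn k); lra.
set g := running_min G t.
have g0 : 0 <= g by exact: running_min_ge.
have window : g * eps * (\sum_(k <= i < t.+1) eta i) <= pd k.
  apply: window_sum_le => //; first exact: ltW.
    by move=> i /andP[_ it]; exact: running_min_le.
  by move=> i /epsM; lra.
have := pd_rate S k S1 small Sk.
have eta0 i : eta i != 0 by rewrite gt_eqF ?open_loop_step_gt0.
have -> : eta k.-1 / eta S.-1 = (eta t.-1 / eta S.-1) * (eta k.-1 / eta t.-1).
  by field; rewrite !eta0.
rewrite exprMn; set E := expR (_ / _); set r := (eta t.-1 / _) ^+ l => pdk.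
have r0 : 0 <= r by rewrite exprn_ge0 // divr_ge0 // ltW ?open_loop_step_gt0.
have E0 : 0 <= E by exact: expR_ge0.
have pdS0 := pd_ge0 S.
(* Origin of the 3 in the exponent: 2 from the ratio of steps at [k] and [t], and 1 from bounding by
   [expR 1] the factor 2 lost to the window mass 1/2. *)
have e1 : 2 <= expR 1 :> R by have := expR_ge1Dx (1 : R); lra.
have -> : expR (3 + M * L ^+ 2 / (2 * S%:R)) = expR 1 * expR 2 * E.
  by rewrite /E -!expRD; congr expR; ring.
rewrite mulrA ler_pdivlMr //.
have half : g * eps * (1 / 2) <= g * eps * (\sum_(k <= i < t.+1) eta i).
  by rewrite ler_wpM2l // mulr_ge0 // ltW.
have pdk2 : pd k <= pd S * (r * expR 2) * E.
  by apply: le_trans pdk _; rewrite ler_wpM2r // ler_wpM2l // ler_wpM2l.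
have : 2 * (pd S * (r * expR 2) * E) <= expR 1 * (pd S * (r * expR 2) * E).
  by rewrite ler_wpM2r // ?mulr_ge0 ?expR_ge0.
have -> : pd S * r * (expR 1 * expR 2 * E) = expR 1 * (pd S * (r * expR 2) * E).
  by ring.
lra.
Qed.

End Rate.
End OpenLoopRate.

(** * The burn-in index and the final assembly *)

(** Shows that the burn-in set is an up-set and identifies its least element. The comparison is made
    in the integers because [l M / 2 - l] may be negative. *)
Lemma burn_in_ceil (R : realType) (l i : nat) (M : R) : (1 <= l)%N ->
  ((1 <= i)%N /\ M * open_loop_step R l i / 2 <= 1) <->
  Num.max 1 (Num.ceil (l%:R * M / 2 - l%:R)) <= i%:Z.
Proof.
move=> l1; rewrite open_loop_step_le // mulr1 ge_max ceil_le_int.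
by rewrite lerBlDr; split=> [[i1 il]|/andP[i1 il]]; first (apply/andP); split.
Qed.

Theorem theorem3p2 (R : realType) (n : nat) (C U : set 'rV[R]_n)
    (f : 'rV[R]_n -> R) (l : nat) (M : R) (x : nat -> 'rV[R]_n)
    (compact_C : compact C) (convex_C : convex_set C)
    (convex_f : convex_function C f)
    (open_U : open U) (subset_CU : C `<=` U)
    (diff_f : forall y, U y -> differentiable f y)
    (l_ge1 : (1 <= l)%N) (M_gt0 : 0 < M)
    (growth : strong_growth C f M 1)
    (fw_x : frank_wolfe C f (open_loop_step R l) x) :
  let eta := open_loop_step R l in
  let burn_in := [set i : nat | (1 <= i)%N /\ M * eta i / 2 <= 1] in
  exists S : nat,
    [/\ burn_in S /\ (forall i, burn_in i -> (S <= i)%N),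
        S%:Z = Num.max 1 (Num.ceil (l%:R * M / 2 - l%:R)),
        let bound (t : nat) : R :=
          primaldual C f x S * (eta t.-1 / eta S.-1) ^+ l
            * expR (M * l%:R ^+ 2 / (2 * S%:R)) in
        (forall t : nat, (S <= t)%N -> primaldual C f x t <= bound t) /\
        bound =O_\oo (fun t : nat => t%:R ^- l : R)
      & forall epsilon : R, 0 < epsilon < 1 ->
        let c := expR (1 / l%:R) in
        let bound (t : nat) : R :=
          primaldual C f x S * (eta t.-1 / eta S.-1) ^+ l
            * (expR (3 + M * l%:R ^+ 2 / (2 * S%:R)) / epsilon) in
        (forall t : nat, (1 <= t)%N ->
           Num.ceil (c * (l%:R * M / (2 * (1 - epsilon))) - l%:R + 1)
             <= t%:Z ->
           running_min (fun i => gap C f (x i)) t <= bound t) /\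
        bound =O_\oo (fun t : nat => t%:R ^- l : R)].
Proof.
move=> eta burn_in.
have Cx := frank_wolfe_mem _ _ _ _ _ _ convex_C (open_loop_step01 R l l_ge1) fw_x.
have df t : differentiable f (x t) by apply/diff_f/subset_CU/Cx.
have descent := frank_wolfe_descent _ _ _ _ _ _ _ (open_loop_step01 R l l_ge1)
  Cx growth fw_x.
have pdE := primaldualE _ _ _ _ _ _ convex_f df Cx fw_x.
have [_ [v xv]] := fw_x.
have G0 t : 0 <= gap C f (x t) by apply: gap_ge0 (Cx t) (xv t).1.
have weak k t : f (x k) - gap C f (x k) <= f (x t).
  by apply: weak_duality convex_f (df k) (Cx k) (Cx t) (xv k).1.
(* Since [N >= 1], its absolute value is the natural number [S]. *)
pose N := Num.max 1 (Num.ceil (l%:R * M / 2 - l%:R)).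
have N1 : 1 <= N by rewrite le_max lexx.
have NS : `|N|%N%:Z = N by rewrite gez0_abs // (le_trans ler01).
have burnP i : burn_in i <-> (`|N| <= i)%N.
  by rewrite /burn_in /= burn_in_ceil // -/N -NS lez_nat.
have [S1 _] := (burnP `|N|%N).2 (leqnn _).
have small i : (`|N| <= i)%N -> M * eta i / 2 <= 1 by move=> /burnP[].
have Smin i : (1 <= i)%N -> M * eta i / 2 <= 1 -> (`|N| <= i)%N.
  by move=> i1 Mi; apply/burnP.
exists `|N|%N; split.
- by split=> [|i /burnP]; first exact/burnP.
- exact: NS.
- move=> bound; split; last exact: open_loop_step_bigO.
  move=> t St; rewrite /bound !pdE.
  exact: (pd_rate R l l_ge1 M _ (fun k => gap C f (x k)) (ltW M_gt0)).
- move=> eps eps01 c bound; split; last exact: open_loop_step_bigO.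
  move=> t t1; rewrite ceil_le_int => tA; rewrite /bound pdE.
  exact: (gap_rate R l l_ge1 M (fun t => f (x t)) _ (ltW M_gt0)).
Qed.
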